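(* For each positive integer $k$, there exists a 4-critical planar graph with exactly $6k+7$ vertices and exactly $14k+12$ edges.
   Context: Graphs are finite and simple. A graph $G$ is $m$-colorable if one can assign one of $m$ colors to each vertex so that no two adjacent vertices get the same color. A graph $G=(V,E)$ is $k$-critical if $G$ is not $(k-1)$-colorable but $G-e$ (the graph obtained by deleting the edge $e$ and keeping all vertices) is $(k-1)$-colorable for every $e\in E(G)$. In particular, $G$ is 4-critical if $G$ is not 3-colorable but $G-e$ is 3-colorable for every edge $e$ of $G$. A graph is planar if it can be drawn in the plane in such a way that its edges intersect only at their endpoints. *)

(* Defs.v *)
From HB Require Import structures.
From mathcomp Require Import all_boot all_order all_algebra.
From mathcomp Require Import all_classical all_reals all_analysis.

Set Implicit Arguments.
Unset Strict Implicit.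
Unset Printing Implicit Defensive.

Import Order.TTheory GRing.Theory Num.Theory.
Import numFieldNormedType.Exports.

Record sgraph := SGraph {
  vertex :> finType;
  edges : {set {set vertex}};
  edges_card2 : forall e : {set vertex}, e \in edges -> #|e| = 2
}.

Section Graphs.
Variable G : sgraph.

Definition adj (u v : G) : bool := [set u; v]%SET \in edges G.

Definition colorable (m : nat) : Prop :=
  exists c : G -> 'I_m, forall u v : G, adj u v -> c u != c v.

Lemma del_edge_card2 (e f : {set G}) : f \in (edges G :\ e)%SET -> #|f| = 2.
Proof. by move=> /setD1P[_]; exact: edges_card2. Qed.

Definition del_edge (e : {set G}) : sgraph := SGraph (@del_edge_card2 e).

End Graphs.

Definition critical (k : nat) (G : sgraph) : Prop :=
  ~ colorable G k.-1 /\
  forall e : {set G}, e \in edges G -> colorable (del_edge e) k.-1.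

Section Planarity.
Local Open Scope classical_set_scope.
Local Open Scope ring_scope.
Variables (R : realType) (G : sgraph).

(* [pos x] is the point representing the vertex [x]; [arc e], restricted to
   [0, 1], parametrizes the simple arc representing the edge [e].  Only the
   values of [arc] at edges of [G], and on [0, 1], are constrained. *)
Record drawing (pos : G -> R * R) (arc : {set G} -> R -> R * R) : Prop :=
  Drawing {
  pos_inj : injective pos;
  arc_continuous : forall e : {set G}, e \in edges G ->
    {within `[0, 1], continuous (arc e)};
  arc_inj : forall e : {set G}, e \in edges G ->
    forall s t : R, s \in `[0, 1] -> t \in `[0, 1] -> arc e s = arc e t -> s = t;
  arc_ends : forall e : {set G}, e \in edges G ->
    [set arc e 0; arc e 1] = [set pos x | x in [set` e]];
  arc_vertex : forall e : {set G}, e \in edges G ->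
    forall (t : R) (x : G), t \in `]0, 1[ -> arc e t <> pos x;
  arc_disjoint : forall e f : {set G}, e \in edges G -> f \in edges G -> e != f ->
    forall s t : R, s \in `]0, 1[ -> t \in `[0, 1] -> arc e s <> arc f t
}.

Definition planar : Prop := exists pos arc, drawing pos arc.

End Planarity.

(* Main.v *)
From Stdlib Require Import ZArith.
Require Import Defs.
From HB Require Import structures.
From mathcomp Require Import all_boot all_order all_algebra.
From mathcomp Require Import all_classical all_reals all_analysis.
From mathcomp Require Import zify ssrZ ring lra.

(** The graphs come from a strip of [m.+1] identical blocks.  A block has six
    vertices x, y, a, b, c, d; consecutive blocks are joined by four edges that
    run from b, c, d of one block to x, y of the next.  A vertex U is joined to
    all the x's, a vertex D to all the b's, and five more vertices P, E, F, G, H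
    close the strip up on its left.  On its right the last b is also joined to U
    and P, and the last d to U.  A further block costs 6 vertices and 10 + 4
    edges, which gives the two counts.

    There is no 3-coloring.  At the right end P is adjacent to U and to D, and
    the last b is adjacent to U, D and P, so U and D have the same color.  Once
    they do, each block passes the colors of its x and y unchanged to the next
    block ([cell_rigid]).  But the right end then forces x = P to hold exactly
    when y <> U ([right_end]), and the left end forces x = P to hold exactly when
    y = U ([left_end]), where vertices stand for their colors.

    Every edge is needed for this.  Each end alone has colorings, and these
    extend along the strip by repeating one coloring of a block.  Deleting an
    edge of an end makes some coloring of the other end admissible there;
    deleting an edge of a block, or of a link, makes it possible to pass from
    blocks colored for the left end to blocks colored for the right end.  So the
    colorings that are needed are finitely many patterns, repeated, and what
    has to be checked about them does not depend on [m]
    ([fixed_rows_ok], [cell_rows_ok], [strip_edge_critical]).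

    The graph is planar because it has a straight-line drawing: the blocks are
    translates of each other inside a horizontal strip, U is above the strip, D
    is below it, P is below and to the left of everything, and the last b is
    pulled out to the lower right, so that the outer face is the triangle on U,
    P and this b.  Two edges are apart since a line separates them, and a line
    with one of a few slopes suffices, except for some edges that meet at U or
    at D.  The coordinates are affine in the numbers of the blocks and in [m], so
    that the inequalities that express this separation hold because all
    coefficients are nonnegative once the parameters are gaps between block
    numbers; this is again a finite check
    ([zends_parted]).  That distinct edges are drawn apart also shows that the
    listed edges are pairwise distinct, hence their number. *)

Set Implicit Arguments.
Unset Strict Implicit.
Unset Printing Implicit Defensive.

Import Order.TTheory GRing.Theory Num.Theory.
Import numFieldNormedType.Exports.

Local Delimit Scope Z_scope with bZ.

(** * The graphs *)

Inductive hub := hU | hD | hP | hE | hF | hG | hH.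
Inductive role := rx | ry | ra | rb | rc | rd.

Definition hubs := [:: hU; hD; hP; hE; hF; hG; hH].
Definition roles := [:: rx; ry; ra; rb; rc; rd].

Definition hub_rank h :=
  match h with hU => 0 | hD => 1 | hP => 2 | hE => 3 | hF => 4 | hG => 5
  | hH => 6 end.
Definition role_rank r :=
  match r with rx => 0 | ry => 1 | ra => 2 | rb => 3 | rc => 4 | rd => 5 end.

Lemma hub_rankK : cancel hub_rank (nth hU hubs). Proof. by case. Qed.
Lemma role_rankK : cancel role_rank (nth rx roles). Proof. by case. Qed.

HB.instance Definition _ := Countable.copy hub (can_type hub_rankK).
HB.instance Definition _ := Countable.copy role (can_type role_rankK).

Lemma hubs_enum : Finite.axiom hubs. Proof. by case. Qed.
Lemma roles_enum : Finite.axiom roles. Proof. by case. Qed.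

HB.instance Definition _ := fintype.isFinite.Build hub hubs_enum.
HB.instance Definition _ := fintype.isFinite.Build role roles_enum.

Lemma card_hub : #|{: hub}| = 7. Proof. by rewrite cardT enumT Finite.enum.unlock. Qed.
Lemma card_role : #|{: role}| = 6. Proof. by rewrite cardT enumT Finite.enum.unlock. Qed.

(** The edges that occur once: the left end, with [f] for the first block, then
    the last block [l] and the right end.  The lists of edges are polymorphic in
    the vertices so that the same lists serve for the graph (vertices), for a
    coloring (colors) and for the drawing (coordinates).  The order matters: the
    first 13 edges are those of the left end, and those from index 11 on are
    those of the last block and the right end; PD and PU belong to both. *)
Definition fixed_edges T (h : hub -> T) (f l : role -> T) : seq (T * T) :=
  [:: (h hP, h hE); (h hP, h hF); (h hE, h hF); (h hE, h hG);
      (h hF, f rx); (h hF, f ry); (h hF, h hH); (h hG, f rx);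
      (h hG, h hU); (h hD, h hH); (h hH, f ry); (h hP, h hD); (h hP, h hU);
      (l rx, h hU); (l rx, l ra); (l rx, l rc); (l ry, l ra); (l ry, l rb);
      (l ra, l rb); (l ra, l rc); (l rb, h hD); (l rb, l rd); (l rc, l rd);
      (l rd, h hU); (l rb, h hU); (h hP, l rb)].

(** The edges of a block [s] that is not the last, and its links to the next
    block [t]. *)
Definition cell_edges T (h : hub -> T) (s t : role -> T) : seq (T * T) :=
  [:: (s rx, h hU); (s rx, s ra); (s rx, s rc); (s ry, s ra); (s ry, s rb);
      (s ra, s rb); (s ra, s rc); (s rb, h hD); (s rb, s rd); (s rc, s rd);
      (s rb, t ry); (s rc, t rx); (s rd, t rx); (s rd, t ry)].

Section Family.
Variable m : nat.

Definition vtx : finType := (hub + 'I_m.+1 * role)%type.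
Definition block (i : nat) (r : role) : vtx := inr (inord i, r).

(** One code for each edge: counting codes counts edges, as [edge_set] will turn
    out to be injective. *)
Definition edge_code : finType := ('I_26 + 'I_m * 'I_14)%type.

Definition ends (c : edge_code) : vtx * vtx :=
  match c with
  | inl j => nth (inl hU, inl hU) (fixed_edges inl (block 0) (block m)) j
  | inr (i, j) => nth (inl hU, inl hU) (cell_edges inl (block i) (block i.+1)) j
  end.

Definition edge_set (c : edge_code) : {set vtx} := [set (ends c).1; (ends c).2]%SET.

Lemma block_inj i j r s : i <= m -> j <= m -> block i r = block j s -> i = j /\ r = s.
Proof.
by move=> im jm [] /(congr1 val); rewrite /= !inordK ?ltnS // => -> ->.
Qed.

Lemma ends_neq c : (ends c).1 != (ends c).2.
Proof.
case: c => [[j lt_j]|[i [j lt_j]]] /=.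
  by do 26?[case: j lt_j => [|j] lt_j //=]; apply/eqP=> -[].
have lt_i := ltn_ord i.
do 14?[case: j lt_j => [|j] lt_j //=]; apply/eqP=> // /block_inj;
  rewrite ?(ltnW lt_i) // => /(_ isT isT); lia.
Qed.

Lemma edge_set_card2 e : e \in [set edge_set c | c : edge_code]%SET -> #|e| = 2.
Proof. by case/imsetP=> c _ ->; rewrite cards2 ends_neq. Qed.

Definition strip : sgraph := SGraph edge_set_card2.

Lemma card_strip : #|strip| = 6 * m.+1 + 7.
Proof. by rewrite card_sum card_prod card_ord card_hub card_role; lia. Qed.

(** An edge is an unordered pair, whereas a code gives an ordered one. *)
Lemma set2_neq (T : finType) (C : eqType) (f : T -> C) (u v p q : T) :
  ([set u; v] = [set p; q])%SET -> f p != f q -> f u != f v.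
Proof.
move=> E; have := set21 p q; have := set22 p q; rewrite -E !inE.
by case/orP=> /eqP-> /orP[] /eqP->; rewrite ?eqxx // eq_sym.
Qed.

Lemma strip_coloring (f : vtx -> 'I_3) : (forall u v, @adj strip u v -> f u != f v) ->
  forall c, f (ends c).1 != f (ends c).2.
Proof. by move=> fP c; apply: fP; apply/imsetP; exists c. Qed.

Lemma del_edge_coloring (c0 : edge_code) (f : vtx -> 'I_3) :
  (forall c, c != c0 -> f (ends c).1 != f (ends c).2) ->
  colorable (@del_edge strip (edge_set c0)) 3.
Proof.
move=> fP; exists f => u v; rewrite /adj /= !inE => /andP[neq /imsetP[c _ E]].
apply: (set2_neq E); apply: fP; apply: contraNneq neq => <-.
by rewrite E.
Qed.

End Family.

(** * Rigidity: there is no 3-coloring *)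

Definition bicolored (e : nat * nat) := e.1 != e.2.

(** Quantification over the words of length [n] on three colors, in a form that
    evaluates. *)
Fixpoint every_word n (P : seq nat -> bool) :=
  if n is n'.+1 then all (fun c => every_word n' (fun s => P (c :: s))) [:: 0; 1; 2]
  else P [::].

Lemma every_wordP P s : all (fun c => c < 3) s -> every_word (size s) P -> P s.
Proof.
elim: s P => [|c s IHs] P //= /andP[lt_c lt_s] /and4P[P0 P1 P2 _].
by case: c lt_c => [|[|[|]]] // _; exact: (IHs (fun s => P (_ :: s))).
Qed.

(** In the next two lemmas the constant 0 stands for a block in which no edge of
    the part of the list concerned has an end. *)
Lemma every_left_end : every_word 9 (fun s =>
  if s is [:: u; d; p; e; f; g; h; x; y] then
    all bicolored (take 13 (fixed_edges (fun k => nth 0 [:: u; d; p; e; f; g; h] (hub_rank k))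
      (fun r => nth 0 [:: x; y] (role_rank r)) (fun=> 0))) ==>
    (u == d) ==> (x != u) ==> ((x == p) == (y == u))
  else true).
Proof. by vm_compute. Qed.

Lemma every_right_end : every_word 9 (fun s =>
  if s is [:: u; d; p; x; y; a; b; c; e] then
    all bicolored (drop 11 (fixed_edges (fun k => nth 0 [:: u; d; p] (hub_rank k))
      (fun=> 0) (fun r => nth 0 [:: x; y; a; b; c; e] (role_rank r)))) ==>
    (u == d) && ((x == p) == (y != u))
  else true).
Proof. by vm_compute. Qed.

Lemma every_cell : every_word 10 (fun s =>
  if s is [:: u; d; x; y; a; b; c; e; x'; y'] then
    all bicolored (cell_edges (fun k => nth 0 [:: u; d] (hub_rank k))
      (fun r => nth 0 [:: x; y; a; b; c; e] (role_rank r))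
      (fun r => nth 0 [:: x'; y'] (role_rank r))) ==>
    (u == d) ==> (x' != u) ==> (x' == x) && (y' == y)
  else true).
Proof. by vm_compute. Qed.

Section Rigidity.
Variables (h : hub -> nat) (s t : role -> nat).
Hypotheses (h3 : forall k, h k < 3) (s3 : forall r, s r < 3) (t3 : forall r, t r < 3).

(** With U and D colored 0 and P colored 1, the pair (x, y) of the first block is
    (1, 0), (2, 1) or (2, 2). *)
Lemma left_end : all bicolored (take 13 (fixed_edges h s t)) ->
  h hU = h hD -> s rx != h hU -> (s rx == h hP) = (s ry == h hU).
Proof.
have := @every_wordP _
  [:: h hU; h hD; h hP; h hE; h hF; h hG; h hH; s rx; s ry] _ every_left_end.
rewrite [all _ _]/= !h3 !s3 => /(_ isT) /implyP E /E /implyP{}E /eqP/E /implyP{}E.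
by move=> /E /eqP.
Qed.

(** The vertices U, D, P and b of the last block are pairwise adjacent except
    for U and D.  With U and D colored 0 and P colored 1, b gets 2 and d gets 1,
    and the pair (x, y) is (2, 0) or (1, 1). *)
Lemma right_end : all bicolored (drop 11 (fixed_edges h s t)) ->
  h hU = h hD /\ (t rx == h hP) = (t ry != h hU).
Proof.
have := @every_wordP _
  [:: h hU; h hD; h hP; t rx; t ry; t ra; t rb; t rc; t rd] _ every_right_end.
rewrite [all _ _]/= !h3 !t3 => /(_ isT) /implyP E /E.
by case/andP => /eqP-> /eqP->.
Qed.

(** What carries the incompatibility of the two ends over an arbitrary length:
    when U and D agree, a block transmits its pair (x, y). *)
Lemma cell_rigid : all bicolored (cell_edges h s t) -> h hU = h hD ->
  t rx != h hU -> t rx = s rx /\ t ry = s ry.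
Proof.
have := @every_wordP _
  [:: h hU; h hD; s rx; s ry; s ra; s rb; s rc; s rd; t rx; t ry] _ every_cell.
rewrite [all _ _]/= !h3 !s3 !t3 => /(_ isT) /implyP E /E /implyP{}E /eqP/E /implyP{}E.
by move=> /E /andP[/eqP-> /eqP->].
Qed.

End Rigidity.

Section Coloring.
Variable m : nat.

Lemma ends_all (Q : pred (vtx m * vtx m)) : (forall c, Q (ends c)) ->
  all Q (fixed_edges inl (block m 0) (block m m)) /\
  forall i, i < m -> all Q (cell_edges inl (block m i) (block m i.+1)).
Proof.
move=> QP; split=> [|i lt_i].
  by apply/(all_nthP (inl hU, inl hU)) => j lt_j;
    exact: (QP (inl (Ordinal (lt_j : j < 26)))).
apply/(all_nthP (inl hU, inl hU)) => j lt_j.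
exact: (QP (inr (Ordinal lt_i, Ordinal (lt_j : j < 14)))).
Qed.

Lemma strip_not_colorable : ~ colorable (strip m) 3.
Proof.
case=> f /strip_coloring fP.
pose h k : nat := f (inl k); pose w i r : nat := f (block m i r).
have h3 k : h k < 3 by exact: ltn_ord.
have w3 i r : w i r < 3 by exact: ltn_ord.
have [fixedP cellP] := @ends_all (fun e => f e.1 != f e.2) fP.
have {fixedP} : all bicolored (fixed_edges h (w 0) (w m)) by exact: fixedP.
have {cellP} cellP i : i < m -> all bicolored (cell_edges h (w i) (w i.+1)) by exact: cellP.
set F := fixed_edges _ _ _ => fixedP.
have part n : all bicolored (take n F) /\ all bicolored (drop n F).
  by apply/andP; rewrite -all_cat cat_take_drop.
have [leftP _] := part 13; have [_ rightP] := part 11.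
have [UD lastP] := right_end h3 (w3 m) rightP.
have xU i : i <= m -> w i rx != h hU.
  rewrite leq_eqVlt => /predU1P[->|/cellP/andP[] //].
  by move/(all_nthP (0, 0)): fixedP => /(_ 13 isT).
have same i : i <= m -> w i rx = w 0 rx /\ w i ry = w 0 ry.
  elim: i => // i IHi lt_i; have [<- <-] := IHi (ltnW lt_i).
  exact: cell_rigid (cellP i lt_i) UD (xU _ lt_i).
have := left_end h3 (w3 0) leftP UD (xU 0 isT).
have [<- <-] := same m (leqnn m).
by rewrite lastP; case: (_ == _).
Qed.

(** * Coloring the graph minus an edge *)

(** When [j] is at least the length of [s] nothing is removed; below, 26 and 14
    are the lengths of the two lists of edges and stand for no deletion. *)
Definition without T j (s : seq T) := take j s ++ drop j.+1 s.

Definition hub_paint (s : seq nat) k := nth 0 s (hub_rank k).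
Definition role_paint (s : seq nat) r := nth 0 s (role_rank r).

(** The conditions on the colors at the two ends, respectively in a block and its
    links, when the [j]-th edge of the list concerned is deleted.  The colors of
    the seven single vertices, and those of a block, are given as words. *)
Definition caps j (h f l : seq nat) :=
  all bicolored (without j (fixed_edges (hub_paint h) (role_paint f) (role_paint l))).
Definition link j (h s t : seq nat) :=
  all bicolored (without j (cell_edges (hub_paint h) (role_paint s) (role_paint t))).

Definition three (s : seq nat) := all (fun c => c < 3) s.

Lemma three_nth s i : three s -> nth 0 s i < 3.
Proof.
move=> s3; have [lt_i|/(nth_default 0)-> //] := ltnP i (size s).
exact: (all_nthP 0 s3).
Qed.

Definition paint (h : seq nat) (w : nat -> seq nat) (v : vtx m) : 'I_3 :=
  match v with
  | inl k => inord (hub_paint h k)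
  | inr (i, r) => inord (role_paint (w i) r)
  end.

Definition deleted_fixed (c : edge_code m) := if c is inl j then j : nat else 26.
Definition deleted_cell (c : edge_code m) i :=
  if c is inr (i', j) then if i' == i :> nat then j : nat else 14 else 14.

Lemma without_nth T (x0 : T) j s i (P : pred T) :
  all P (without j s) -> i < size s -> i != j -> P (nth x0 s i).
Proof.
move=> /(all_nthP x0) sP lt_i; rewrite neq_ltn => /orP[lt_ij|lt_ji].
  have := sP i; rewrite size_cat nth_cat size_take_min size_drop nth_take //.
  have -> : i < minn j (size s) by lia.
  by apply; lia.
have := sP i.-1; rewrite size_cat nth_cat size_take_min size_drop nth_drop.
have -> : i.-1 < minn j (size s) = false by lia.
have -> : j.+1 + (i.-1 - minn j (size s)) = i by lia.
by apply; lia.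
Qed.

Lemma nth_fixed_map T U (g : T -> U) x0 h f l j : j < 26 ->
  nth (g x0, g x0) (fixed_edges (g \o h) (g \o f) (g \o l)) j =
  let e := nth (x0, x0) (fixed_edges h f l) j in (g e.1, g e.2).
Proof.
by move=> lt_j;
  exact: (@nth_map _ (x0, x0) _ (g x0, g x0) (fun e => (g e.1, g e.2)) j
    (fixed_edges h f l) lt_j).
Qed.

Lemma nth_cell_map T U (g : T -> U) x0 h s t j : j < 14 ->
  nth (g x0, g x0) (cell_edges (g \o h) (g \o s) (g \o t)) j =
  let e := nth (x0, x0) (cell_edges h s t) j in (g e.1, g e.2).
Proof.
by move=> lt_j;
  exact: (@nth_map _ (x0, x0) _ (g x0, g x0) (fun e => (g e.1, g e.2)) j
    (cell_edges h s t) lt_j).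
Qed.

(** Only neighboring blocks interact, so a coloring of the graph minus an edge
    amounts to a sequence of colored blocks [w] whose ends and links are right. *)
Lemma paint_deleted h w (c0 : edge_code m) :
  three h -> (forall i, i <= m -> three (w i)) ->
  caps (deleted_fixed c0) h (w 0) (w m) ->
  (forall i, i < m -> link (deleted_cell c0 i) h (w i) (w i.+1)) ->
  colorable (@del_edge (strip m) (edge_set c0)) 3.
Proof.
move=> h3 w3 capP linkP; apply: (@del_edge_coloring m c0 (paint h w)) => c neq_c.
pose g v : nat := paint h w v.
have gh : g \o inl =1 hub_paint h by move=> k /=; rewrite /g /= inordK // three_nth.
have gw i : i <= m -> g \o block m i =1 role_paint (w i).
  by move=> le_i r; rewrite /g /= !inordK ?three_nth ?inordK ?w3.
suff: bicolored (g (ends c).1, g (ends c).2) by [].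
case: c neq_c => [j|[i j]] neq_c /=.
  have := @nth_fixed_map _ _ g (inl hU) inl (block m 0) (block m m) j (ltn_ord j).
  move=> /= <-; apply: (@without_nth _ _ (deleted_fixed c0)) => //; last first.
    by apply: contraNneq neq_c; case: c0 {capP linkP} => [j'|[i' j']] /= E;
       [apply/eqP; congr inl; exact: val_inj|have := ltn_ord j; rewrite E].
  by move: capP; rewrite /caps /fixed_edges !gh !gw.
have lt_i := ltn_ord i.
have := @nth_cell_map _ _ g (inl hU) inl (block m i) (block m i.+1) j (ltn_ord j).
move=> /= <-; apply: (@without_nth _ _ (deleted_cell c0 i)) => //; last first.
  apply: contraNneq neq_c; case: c0 {capP linkP} => [j'|[i' j']] /=.
    by have := ltn_ord j; move=> + E; rewrite E.
  case: eqP => [/val_inj-> /val_inj-> //|_ E].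
  by have := ltn_ord j; rewrite E.
by move: (linkP i lt_i); rewrite /link /cell_edges !gh !gw // ltnW.
Qed.

End Coloring.

(** Colorings of a block, as words on x, y, a, b, c, d, that can be repeated along
    the strip when U and D have color 0.  The digits in the names are the colors
    of x and y.  Those called l fit the left end and those called r the right
    end, P having color 1; [r11'] replaces [r11] in the last block, where d is
    adjacent to U. *)
Definition l10 := [:: 1; 0; 2; 1; 0; 2].
Definition l21 := [:: 2; 1; 0; 2; 1; 0].
Definition l22 := [:: 2; 2; 0; 1; 1; 0].
Definition r20 := [:: 2; 0; 1; 2; 0; 1].
Definition r11 := [:: 1; 1; 0; 2; 2; 0].
Definition r11' := [:: 1; 1; 0; 2; 2; 1].

(** For each edge of [fixed_edges], a coloring of the graph without it: the colors
    of U, D, P, E, F, G, H, then the blocks.  The first word is that of all blocks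
    but the last two, and the next ones those of the last two blocks. *)
Definition fixed_rows : seq (seq (seq nat)) :=
  [::
   [:: [:: 0; 0; 1; 1; 0; 2; 2]; r11; r11; r11'];
   [:: [:: 0; 0; 1; 0; 1; 1; 2]; r20; r20; r20];
   [:: [:: 0; 0; 1; 0; 0; 2; 2]; r11; r11; r11'];
   [:: [:: 0; 0; 1; 2; 0; 2; 2]; r11; r11; r11'];
   [:: [:: 0; 0; 1; 0; 2; 1; 1]; r20; r20; r20];
   [:: [:: 0; 0; 1; 2; 0; 1; 1]; r20; r20; r20];
   [:: [:: 0; 0; 1; 0; 2; 2; 2]; r11; r11; r11'];
   [:: [:: 0; 0; 1; 2; 0; 1; 2]; r11; r11; r11'];
   [:: [:: 0; 0; 1; 2; 0; 0; 2]; r11; r11; r11'];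
   [:: [:: 0; 0; 1; 0; 2; 2; 0]; r11; r11; r11'];
   [:: [:: 0; 0; 1; 0; 2; 2; 1]; r11; r11; r11'];
   [:: [:: 0; 1; 1; 0; 2; 2; 0]; r11; r11; r11'];
   [:: [:: 0; 1; 0; 2; 1; 1; 2]; r20; r20; r20];
   [:: [:: 0; 0; 1; 2; 0; 1; 1]; l22; [:: 2; 2; 0; 1; 1; 2]; [:: 0; 0; 1; 2; 2; 1]];
   [:: [:: 0; 0; 1; 0; 2; 2; 1]; l10; l10; [:: 1; 0; 1; 2; 0; 1]];
   [:: [:: 0; 0; 1; 2; 0; 1; 2]; l21; l21; [:: 2; 1; 0; 2; 2; 1]];
   [:: [:: 0; 0; 1; 0; 2; 2; 1]; l10; l10; [:: 1; 0; 0; 2; 2; 1]];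
   [:: [:: 0; 0; 1; 2; 0; 1; 1]; l22; l22; [:: 2; 2; 1; 2; 0; 1]];
   [:: [:: 0; 0; 1; 0; 2; 2; 1]; l10; l10; [:: 1; 0; 2; 2; 0; 1]];
   [:: [:: 0; 0; 1; 2; 0; 1; 2]; l21; l21; [:: 2; 1; 0; 2; 0; 1]];
   [:: [:: 0; 1; 2; 0; 1; 1; 0]; [:: 2; 2; 1; 0; 0; 1]; [:: 2; 2; 1; 0; 0; 1]; [:: 2; 2; 0; 1; 1; 2]];
   [:: [:: 0; 0; 1; 2; 0; 1; 2]; l21; l21; [:: 2; 1; 0; 2; 1; 2]];
   [:: [:: 0; 0; 1; 2; 0; 1; 2]; l21; l21; [:: 2; 1; 0; 2; 1; 1]];
   [:: [:: 0; 0; 1; 2; 0; 1; 2]; l21; l21; l21];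
   [:: [:: 0; 1; 2; 0; 1; 1; 0]; [:: 2; 2; 1; 0; 0; 1]; [:: 2; 2; 1; 0; 0; 1]; [:: 2; 2; 1; 0; 0; 1]];
   [:: [:: 0; 0; 1; 0; 2; 2; 1]; l10; l10; l10]].

(** For each edge of [cell_edges], a coloring of the graph without its copy in
    block [i]: the colors of the single vertices, then the blocks before [i - 1],
    block [i - 1], block [i], the blocks after [i], and the last block. *)
Definition cell_rows : seq (seq (seq nat)) :=
  [::
   [:: [:: 0; 0; 1; 2; 0; 1; 1]; l22; [:: 2; 2; 0; 1; 1; 2]; [:: 0; 0; 1; 2; 2; 0]; r11; r11'];
   [:: [:: 0; 0; 1; 0; 2; 2; 1]; l10; l10; [:: 1; 0; 1; 2; 0; 1]; r20; r20];
   [:: [:: 0; 0; 1; 2; 0; 1; 2]; l21; l21; [:: 2; 1; 0; 2; 2; 0]; r11; r11'];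
   [:: [:: 0; 0; 1; 2; 0; 1; 2]; l21; l21; [:: 2; 1; 1; 2; 0; 1]; r20; r20];
   [:: [:: 0; 0; 1; 2; 0; 1; 1]; l22; l22; [:: 2; 2; 1; 2; 0; 1]; r20; r20];
   [:: [:: 0; 0; 1; 0; 2; 2; 1]; l10; l10; [:: 1; 0; 2; 2; 0; 1]; r20; r20];
   [:: [:: 0; 0; 1; 2; 0; 1; 2]; l21; l21; [:: 2; 1; 0; 2; 0; 1]; r20; r20];
   [:: [:: 0; 0; 1; 2; 0; 1; 1]; l22; l22; [:: 2; 2; 1; 0; 0; 2]; r11; r11'];
   [:: [:: 0; 0; 1; 0; 2; 2; 1]; l10; l10; [:: 1; 0; 2; 1; 0; 1]; r20; r20];
   [:: [:: 0; 0; 1; 2; 0; 1; 2]; l21; l21; [:: 2; 1; 0; 2; 1; 1]; r20; r20];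
   [:: [:: 0; 0; 1; 0; 2; 2; 1]; l10; l10; l10; r11; r11'];
   [:: [:: 0; 0; 1; 2; 0; 1; 2]; l21; l21; l21; r11; r11'];
   [:: [:: 0; 0; 1; 0; 2; 2; 1]; l10; l10; l10; r20; r20];
   [:: [:: 0; 0; 1; 2; 0; 1; 1]; l22; l22; l22; r20; r20]].

(** Deleting the edge xU lets x have the color of U, and the block before has to
    be recolored to allow for that; when x lies in the first block, the vertices
    of the left end have to be recolored instead. *)
Definition fixed_row (first : bool) j : seq (seq nat) :=
  if first && (j == 13) then
    [:: [:: 0; 0; 1; 0; 2; 1; 1]; r11; r11; [:: 0; 0; 1; 2; 2; 1]]
  else nth [::] fixed_rows j.

Definition cell_row (first : bool) j : seq (seq nat) :=
  if first && (j == 0) then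
    [:: [:: 0; 0; 1; 0; 2; 1; 1]; r11; r11; [:: 0; 0; 1; 2; 2; 0]; r11; r11']
  else nth [::] cell_rows j.

Section Rows.
Variable row : seq (seq nat).
Let part := nth [::] row.

(** Which word of the row colors block [n] when the deletion takes place in block
    [i]; for an edge of [fixed_edges], [i] is the last block [m]. *)
Definition phase m i n :=
  if n.+1 < i then 1 else if n < i then 2 else if n == i then 3
  else if n < m then 4 else 5.

Definition before := [&& link 14 (part 0) (part 1) (part 1),
  link 14 (part 0) (part 1) (part 2) & link 14 (part 0) (part 2) (part 3)].
Definition after j := [&& link j (part 0) (part 3) (part 4),
  link j (part 0) (part 3) (part 5), link 14 (part 0) (part 4) (part 4) &
  link 14 (part 0) (part 4) (part 5)].

Lemma before_link m i n : before -> n < i ->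
  link 14 (part 0) (part (phase m i n)) (part (phase m i n.+1)).
Proof.
case/and3P=> b11 b12 b23 lt_n; rewrite /phase lt_n.
have [lt1|] := ltnP n.+1 i; first by case: ifP.
by move=> le_i; have -> : i = n.+1 by [lia]; rewrite ltnNge leqnSn eqxx.
Qed.

Lemma after_link m i j n : after j -> i <= n < m ->
  link (if i == n then j else 14) (part 0) (part (phase m i n)) (part (phase m i n.+1)).
Proof.
case/and4P=> a34 a35 a44 a45 /andP[le_n lt_n].
rewrite /phase lt_n; have -> : n.+1 < i = false by lia.
have -> : n < i = false by lia.
have -> : n.+2 < i = false by lia.
have -> : n.+1 == i = false by lia.
by rewrite [n == i]eq_sym; case: (i == n); case: ltnP.
Qed.

Lemma part_three i : all three row -> three (part i).
Proof.
move=> row3; have [lt_i|/(nth_default [::])] := ltnP i (size row); last by rewrite /part => ->.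
exact: (all_nthP [::] row3).
Qed.

End Rows.

Definition fixed_row_ok first j :=
  let row := fixed_row first j in let part := nth [::] row in
  all three row && if first then caps j (part 0) (part 3) (part 3) else
  [&& caps j (part 0) (part 1) (part 3), caps j (part 0) (part 2) (part 3) & before row].

Definition cell_row_ok first j :=
  let row := cell_row first j in let part := nth [::] row in
  [&& all three row, after row j &
  if first then caps 26 (part 0) (part 3) (part 5) else
  [&& caps 26 (part 0) (part 1) (part 5), caps 26 (part 0) (part 2) (part 5) & before row]].

Lemma fixed_rows_ok first j : j < 26 -> fixed_row_ok first j.
Proof.
have: all (fun j => fixed_row_ok true j && fixed_row_ok false j) (iota 0 26) by vm_compute.
move=> /allP ok lt_j; have /andP[] : fixed_row_ok true j && fixed_row_ok false j.
  by apply: ok; rewrite mem_iota.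
by case: first.
Qed.

Lemma cell_rows_ok first j : j < 14 -> cell_row_ok first j.
Proof.
have: all (fun j => cell_row_ok true j && cell_row_ok false j) (iota 0 14) by vm_compute.
move=> /allP ok lt_j; have /andP[] : cell_row_ok true j && cell_row_ok false j.
  by apply: ok; rewrite mem_iota.
by case: first.
Qed.

Lemma strip_edge_critical m (c : edge_code m) :
  colorable (@del_edge (strip m) (edge_set c)) 3.
Proof.
case: c => [j|[i j]].
  have := fixed_rows_ok (m == 0) (ltn_ord j).
  rewrite /fixed_row_ok; set row := fixed_row _ _; case/andP=> row3 ok.
  apply: (@paint_deleted m (nth [::] row 0) (fun n => nth [::] row (phase m m n))) => /=.
  - exact: part_three.
  - by move=> n _; exact: part_three.
  - move: ok; rewrite [phase m m m]/phase ltnNge leqnSn ltnn eqxx /phase.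
    by case: (m) => [|[|m']] //= /and3P[].
  - move=> n lt_n; apply: before_link (lt_n); move: ok.
    by have -> : m == 0 = false by [lia]; case/and3P.
have := cell_rows_ok (i == 0 :> nat) (ltn_ord j).
rewrite /cell_row_ok; set row := cell_row _ _ => /and3P[row3 row_after ok].
have lt_i := ltn_ord i.
apply: (@paint_deleted m (nth [::] row 0) (fun n => nth [::] row (phase m i n))) => /=.
- exact: part_three.
- by move=> n _; exact: part_three.
- have -> : phase m i m = 5.
    by rewrite /phase; have -> : m.+1 < i = false by [lia];
       have -> : m < i = false by [lia]; have -> : m == i = false by [lia]; rewrite ltnn.
  rewrite /phase; move: ok; clear.
  by move: (nat_of_ord i) => [|[|i']] //= /and3P[].
- move=> n lt_n; have [lt_ni|le_in] := ltnP n i; last first.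
    by rewrite after_link // le_in.
  have -> : (i == n :> nat) = false by lia.
  apply: before_link => //; move: ok.
  by have -> : (i == 0 :> nat) = false by [lia]; case/and3P.
Qed.

(** * Coordinates *)

(** An affine form c + cp p + cq q + cr r in three parameters, which will be
    natural numbers. *)
Definition form := (Z * Z * Z * Z)%type.
Definition eval (p q r : Z) (f : form) : Z :=
  let: (c, cp, cq, cr) := f in (c + cp * p + cq * q + cr * r)%bZ.
Definition fadd (f g : form) : form :=
  let: (a, b, c, d) := f in let: (a', b', c', d') := g in
  (a + a', b + b', c + c', d + d')%bZ.
Definition fscale (k : Z) (f : form) : form :=
  let: (a, b, c, d) := f in (k * a, k * b, k * c, k * d)%bZ.
Definition fconst (k : Z) : form := (k, 0, 0, 0)%bZ.
(** Nonnegative coefficients make a form nonnegative for all values of the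
    parameters, which turns inequalities between coordinates into a
    computation. *)
Definition fnonneg (f : form) :=
  let: (a, b, c, d) := f in [&& 0 <=? a, 0 <=? b, 0 <=? c & 0 <=? d]%bZ.
Definition fpos (f : form) := let: (a, _, _, _) := f in (0 <? a)%bZ && fnonneg f.

Lemma eval_fadd p q r f g : eval p q r (fadd f g) = (eval p q r f + eval p q r g)%bZ.
Proof. by case: f g => [[[? ?] ?] ?] [[[? ?] ?] ?]; cbn; ring. Qed.

Lemma eval_fscale p q r k f : eval p q r (fscale k f) = (k * eval p q r f)%bZ.
Proof. by case: f => [[[? ?] ?] ?]; cbn; ring. Qed.

(** The point (x, y) moving with a number n at speed (kx, ky), as
    (x, y, (kx, ky)). *)
Definition coords := (Z * Z * (Z * Z))%type.

(** Here n is the number [m] of the last block.  The point U has to see all the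
    x's, which are on the line of height 6, but also d and b of the last block,
    which are lower: it is on the line x + y = 8 m + 9, these two are beyond this
    line, at 8 m + 10 and 8 m + 12, and all others are before it. *)
Definition hub_coords h : coords :=
  match h with
  | hU => (-6, 15, (0, 8)) | hD => (-3, -1, (0, 0)) | hP => (-8, -3, (0, 0))
  | hE => (-5, 5, (0, 0)) | hF => (-3, 3, (0, 0)) | hG => (-3, 6, (0, 0))
  | hH => (-3, 0, (0, 0))
  end%bZ.

(** In a block with number n the x's are on top and the b's at the bottom, where
    they are visible from above and from below. *)
Definition block_coords r : coords :=
  match r with
  | rx => (0, 6, (8, 0)) | ry => (0, 2, (8, 0)) | ra => (1, 3, (8, 0))
  | rb => (3, 0, (8, 0)) | rc => (3, 5, (8, 0)) | rd => (5, 3, (8, 0))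
  end%bZ.

(** The last block has no links to the right, and its b and d are moved out: b
    goes below D and above P, so that the edge from P passes under D. *)
Definition last_coords r : coords :=
  match r with
  | rb => (14, -2, (8, 0)) | rd => (8, 2, (8, 0)) | _ => block_coords r
  end%bZ.

Definition at_Z (c : coords) (n : Z) : Z * Z :=
  let: (x, y, (kx, ky)) := c in (x + kx * n, y + ky * n)%bZ.
Definition at_form (c : coords) (n : form) : form * form :=
  let: (x, y, (kx, ky)) := c in
  (fadd (fconst x) (fscale kx n), fadd (fconst y) (fscale ky n)).

Definition eval2 p q r (u : form * form) := (eval p q r u.1, eval p q r u.2).

Lemma eval_at p q r c n : eval2 p q r (at_form c n) = at_Z c (eval p q r n).
Proof.
case: c => [[x y] [kx ky]]; rewrite /eval2 /at_form /at_Z; cbn [fst snd].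
by rewrite !eval_fadd !eval_fscale; congr pair; congr Z.add; rewrite /=; lia.
Qed.

Definition dot (d u : Z * Z) : Z := (d.1 * u.1 + d.2 * u.2)%bZ.

Definition segment := ((Z * Z) * (Z * Z))%type.

Definition split_by d (e f : segment) :=
  [/\ (dot d f.1 <= dot d e.1)%bZ, (dot d f.2 <= dot d e.1)%bZ,
      (dot d f.1 <= dot d e.2)%bZ & (dot d f.2 <= dot d e.2)%bZ].

Definition strictly_split_by d (e f : segment) :=
  [/\ (dot d f.1 < dot d e.1)%bZ, (dot d f.2 < dot d e.1)%bZ,
      (dot d f.1 < dot d e.2)%bZ & (dot d f.2 < dot d e.2)%bZ].

Definition flip T (e : T * T) := (e.2, e.1).

(** Two edges with a common end whose other ends are on one line that misses the
    common end. *)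
Definition fan (e f : segment) := e.1 = f.1 /\
  exists d, [/\ dot d e.2 = dot d f.2, dot d e.1 <> dot d e.2 & e.2 <> f.2].

(** Three reasons for the interior of [e] to avoid [f].  In the first one the
    separating line may touch both segments, but only at an end of [e], because
    [e] is not parallel to it.  The third is needed for the edges at U, and at D,
    whose directions get arbitrarily close, so that no fixed choice of slopes
    separates them. *)
Definition parted (e f : segment) :=
  (exists d, split_by d e f /\ dot d e.1 <> dot d e.2) \/
  (exists d, strictly_split_by d e f) \/
  [\/ fan e f, fan e (flip f), fan (flip e) f | fan (flip e) (flip f)].

Definition fdiff d (u v : form * form) : form :=
  fadd (fscale d.1 (fadd u.1 (fscale (-1)%bZ v.1)))
       (fscale d.2 (fadd u.2 (fscale (-1)%bZ v.2))).

Lemma eval_fdiff p q r d u v :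
  eval p q r (fdiff d u v) = (dot d (eval2 p q r u) - dot d (eval2 p q r v))%bZ.
Proof.
rewrite /fdiff !eval_fadd !eval_fscale !eval_fadd !eval_fscale /dot /eval2.
by cbn [fst snd]; ring.
Qed.

Fixpoint some T (P : T -> bool) s :=
  if s is x :: s' then if P x then true else some P s' else false.

Lemma someP T (P : T -> bool) s : some P s -> exists x, P x.
Proof. by elim: s => //= x s IHs; case: ifP => [Px _|_ /IHs//]; exists x. Qed.

(** Normal vectors of the separating lines. *)
Definition directions : seq (Z * Z) :=
  let ks := [:: -4; -3; -2; -1; 0; 1; 2; 3; 4]%bZ in
  [seq (a, b) | a <- ks, b <- ks].

Definition below d u v := fnonneg (fdiff d v u).
Definition strictly_below d u v := fpos (fdiff d v u).
Definition uneven d u v := strictly_below d u v || strictly_below d v u.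

Notation fsegment := ((form * form) * (form * form))%type.

Definition fparted_by (e f : fsegment) d :=
  [&& below d f.1 e.1, below d f.2 e.1, below d f.1 e.2, below d f.2 e.2 &
  (uneven d e.1 e.2 ||
   [&& strictly_below d f.1 e.1, strictly_below d f.2 e.1,
       strictly_below d f.1 e.2 & strictly_below d f.2 e.2])].

Definition ffan (e f : fsegment) := (e.1 == f.1) &&
  (uneven (1, 0)%bZ e.2 f.2 || uneven (0, 1)%bZ e.2 f.2) &&
  some (fun d => [&& uneven d e.1 e.2, below d e.2 f.2 & below d f.2 e.2]) directions.

Definition fparted (e f : fsegment) :=
  if some (fparted_by e f) directions then true else
  [|| ffan e f, ffan e (flip f), ffan (flip e) f | ffan (flip e) (flip f)].

Definition all_parted (s : seq fsegment) :=
  let z := (fconst 0%bZ, fconst 0%bZ) in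
  all (fun i => all (fun j => if i == j then true else
    fparted (nth (z, z) s i) (nth (z, z) s j)) (iota 0 (size s))) (iota 0 (size s)).

Definition cross_parted (s t : seq fsegment) :=
  all (fun e => all (fun f => fparted e f && fparted f e) t) s.

Definition fixed_form (n : form) : seq fsegment :=
  fixed_edges (fun h => at_form (hub_coords h) n)
    (fun r => at_form (block_coords r) (fconst 0%bZ))
    (fun r => at_form (last_coords r) n).

Definition cell_form (i n : form) : seq fsegment :=
  cell_edges (fun h => at_form (hub_coords h) n)
    (fun r => at_form (block_coords r) i)
    (fun r => at_form (block_coords r) (fadd i (fconst 1%bZ))).

(** In these five checks [p] is the number of a block, [q] a gap between two
    blocks, and [r] a gap before the last block (or the number of the last block,
    in the first check).  Blocks with consecutive numbers are checked apart from
    those at distance at least 2, as different lines separate them. *)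
Lemma fixed_parted : all_parted (fixed_form (0, 0, 0, 1)%bZ).
Proof. by vm_compute. Qed.

Lemma fixed_cell_parted :
  cross_parted (fixed_form (1, 1, 0, 1)%bZ) (cell_form (0, 1, 0, 0)%bZ (1, 1, 0, 1)%bZ).
Proof. by vm_compute. Qed.

Lemma cell_parted : all_parted (cell_form (0, 1, 0, 0)%bZ (1, 1, 0, 1)%bZ).
Proof. by vm_compute. Qed.

Lemma next_cell_parted :
  cross_parted (cell_form (0, 1, 0, 0)%bZ (2, 1, 0, 1)%bZ)
               (cell_form (1, 1, 0, 0)%bZ (2, 1, 0, 1)%bZ).
Proof. by vm_compute. Qed.

Lemma far_cell_parted :
  cross_parted (cell_form (0, 1, 0, 0)%bZ (3, 1, 1, 1)%bZ)
               (cell_form (2, 1, 1, 0)%bZ (3, 1, 1, 1)%bZ).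
Proof. by vm_compute. Qed.

Section Eval.
Variables p q r : Z.
Hypotheses (p0 : (0 <= p)%bZ) (q0 : (0 <= q)%bZ) (r0 : (0 <= r)%bZ).

Lemma eval_fnonneg f : fnonneg f -> (0 <= eval p q r f)%bZ.
Proof.
case: f => [[[c a] b] d] /and4P[c0 a0 b0 d0] /=.
have /= mul_ge0 x y : (0 <=? x)%bZ -> (0 <= y)%bZ -> (0 <= x * y)%bZ by nia.
have := mul_ge0 _ _ a0 p0; have := mul_ge0 _ _ b0 q0; have := mul_ge0 _ _ d0 r0.
lia.
Qed.

Lemma eval_fpos f : fpos f -> (0 < eval p q r f)%bZ.
Proof.
case: f => [[[c a] b] d] /andP[c0 /and4P[_ a0 b0 d0]].
have := @eval_fnonneg (0%bZ, a, b, d); rewrite /fnonneg a0 b0 d0 => /(_ isT) /=.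
lia.
Qed.

Local Notation ev := (eval2 p q r).
Definition eseg (e : fsegment) : segment := (ev e.1, ev e.2).

Lemma below_dot d u v : below d u v -> (dot d (ev u) <= dot d (ev v))%bZ.
Proof. by move/eval_fnonneg; rewrite eval_fdiff; lia. Qed.

Lemma strictly_below_dot d u v : strictly_below d u v -> (dot d (ev u) < dot d (ev v))%bZ.
Proof. by move/eval_fpos; rewrite eval_fdiff; lia. Qed.

Lemma uneven_dot d u v : uneven d u v -> dot d (ev u) <> dot d (ev v).
Proof. by case/orP=> /strictly_below_dot; lia. Qed.

Lemma ffan_fan e f : ffan e f -> fan (eseg e) (eseg f).
Proof.
case/andP=> /andP[/eqP E neq] /someP[d /and3P[une ble bge]]; split; first by rewrite /= E.
exists d; split; last 1 first.
- by move=> /= E'; case/orP: neq => /uneven_dot; rewrite E'.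
- by have /= := below_dot ble; have /= := below_dot bge; lia.
- exact: (uneven_dot une).
Qed.

Lemma fparted_parted e f : fparted e f -> parted (eseg e) (eseg f).
Proof.
rewrite /fparted; case: ifP => [/someP[d dP] _|_ fans].
  case/and5P: dP => b11 b21 b12 b22 /orP[une|/and4P[s11 s21 s12 s22]].
    left; exists d; split; last exact: uneven_dot une.
    by split; apply: below_dot.
  by right; left; exists d; split; apply: strictly_below_dot.
right; right; case/or4P: fans => /ffan_fan fP.
- by constructor 1.
- by constructor 2.
- by constructor 3.
- by constructor 4.
Qed.

End Eval.

Lemma all_partedP p q r s i j : (0 <= p)%bZ -> (0 <= q)%bZ -> (0 <= r)%bZ ->
  all_parted s -> i < size s -> j < size s -> i != j ->
  forall z, parted (nth z (map (eseg p q r) s) i) (nth z (map (eseg p q r) s) j).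
Proof.
move=> p0 q0 r0 /allP sP lt_i lt_j neq z; set z0 := fconst 0%bZ in sP.
rewrite !(nth_map ((z0, z0), (z0, z0))) //; apply: fparted_parted => //.
have in_iota k : k < size s -> k \in iota 0 (size s) by rewrite mem_iota.
by have /allP/(_ j (in_iota j lt_j)) := sP i (in_iota i lt_i); rewrite (negbTE neq).
Qed.

Lemma cross_partedP p q r s t i j : (0 <= p)%bZ -> (0 <= q)%bZ -> (0 <= r)%bZ ->
  cross_parted s t -> i < size s -> j < size t ->
  forall z, let e := nth z (map (eseg p q r) s) i in
            let f := nth z (map (eseg p q r) t) j in parted e f /\ parted f e.
Proof.
move=> p0 q0 r0 /allP sP lt_i lt_j z; set z0 := fconst 0%bZ.
have /allP/(_ (nth ((z0, z0), (z0, z0)) t j)) := sP _ (mem_nth ((z0, z0), (z0, z0)) lt_i).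
rewrite mem_nth // => /(_ isT) /andP[ef fe].
by rewrite /= !(nth_map ((z0, z0), (z0, z0))) //; split; apply: fparted_parted.
Qed.

Section Position.
Variable m : nat.
Local Notation Zn := Z.of_nat.

Definition posZ (v : vtx m) : Z * Z :=
  match v with
  | inl h => at_Z (hub_coords h) (Zn m)
  | inr (i, r) =>
    at_Z (if i == m :> nat then last_coords r else block_coords r) (Zn i)
  end.

Lemma posZ_block i r : i < m -> posZ (block m i r) = at_Z (block_coords r) (Zn i).
Proof.
move=> lt_i; rewrite /posZ /block inordK; last by rewrite ltnS ltnW.
by rewrite (ltn_eqF lt_i).
Qed.

Lemma posZ_last r : posZ (block m m r) = at_Z (last_coords r) (Zn m).
Proof. by rewrite /posZ /block inordK // eqxx. Qed.

Lemma posZ_left i : i <= m ->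
  posZ (block m i rx) = at_Z (block_coords rx) (Zn i) /\
  posZ (block m i ry) = at_Z (block_coords ry) (Zn i).
Proof.
rewrite leq_eqVlt => /predU1P[->|lt_i]; first by rewrite !posZ_last.
by rewrite !posZ_block.
Qed.

Definition zends (c : edge_code m) : segment := (posZ (ends c).1, posZ (ends c).2).

Lemma zends_fixed p q r n j : eval p q r n = Zn m ->
  forall lt_j : j < 26, zends (inl (Ordinal lt_j)) =
  nth (0, 0, (0, 0))%bZ (map (eseg p q r) (fixed_form n)) j.
Proof.
move=> En lt_j.
have -> : map (eseg p q r) (fixed_form n) =
  map (fun e => (posZ e.1, posZ e.2)) (fixed_edges inl (block m 0) (block m m)).
  rewrite /fixed_form /fixed_edges /eseg; cbn [map fst snd].
  have [-> ->] := posZ_left (leq0n m).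
  by rewrite !posZ_last !eval_at En.
by rewrite (nth_map (inl hU, inl hU)).
Qed.

Lemma zends_cell p q r fi n (i : 'I_m) j : eval p q r n = Zn m ->
  eval p q r fi = Zn i -> forall lt_j : j < 14, zends (inr (i, Ordinal lt_j)) =
  nth (0, 0, (0, 0))%bZ (map (eseg p q r) (cell_form fi n)) j.
Proof.
move=> En Ei lt_j.
have -> : map (eseg p q r) (cell_form fi n) =
  map (fun e => (posZ e.1, posZ e.2)) (cell_edges inl (block m i) (block m i.+1)).
  rewrite /cell_form /cell_edges /eseg; cbn [map fst snd].
  have [-> ->] := posZ_left (ltn_ord i).
  rewrite !(posZ_block _ (ltn_ord i)) !eval_at En eval_fadd Ei.
  by have -> : (Zn i + eval p q r (fconst 1) = Zn i.+1)%bZ by rewrite /=; lia.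
by rewrite (nth_map (inl hU, inl hU)).
Qed.

(** The two edges are instances of the symbolic ones, with parameters read off
    from the order of the block numbers involved. *)
Lemma zends_parted c c' : c != c' -> parted (zends c) (zends c').
Proof.
have cell2 (i i' : 'I_m) (j j' : 'I_14) : i < i' ->
  parted (zends (inr (i, j))) (zends (inr (i', j'))) /\
  parted (zends (inr (i', j'))) (zends (inr (i, j))).
  case: j j' => [j lt_j] [j' lt_j']; have lt_i' := ltn_ord i'.
  rewrite leq_eqVlt => /predU1P[eq_i|lt_i].
    rewrite (@zends_cell (Zn i) 0 (Zn (m - i - 2)) (0, 1, 0, 0)%bZ (2, 1, 0, 1)%bZ);
      try by rewrite /eval; lia.
    rewrite (@zends_cell (Zn i) 0 (Zn (m - i - 2)) (1, 1, 0, 0)%bZ (2, 1, 0, 1)%bZ);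
      try by rewrite /eval; lia.
    by apply: cross_partedP next_cell_parted _ _ _ => //; lia.
  rewrite (@zends_cell (Zn i) (Zn (i' - i - 2)) (Zn (m - i' - 1)) (0, 1, 0, 0)%bZ (3, 1, 1, 1)%bZ);
    try by rewrite /eval; lia.
  rewrite (@zends_cell (Zn i) (Zn (i' - i - 2)) (Zn (m - i' - 1)) (2, 1, 1, 0)%bZ (3, 1, 1, 1)%bZ);
    try by rewrite /eval; lia.
  by apply: cross_partedP far_cell_parted _ _ _ => //; lia.
have cellf (i : 'I_m) (j : 'I_14) (j' : 'I_26) :
  parted (zends (inl j')) (zends (inr (i, j))) /\
  parted (zends (inr (i, j))) (zends (inl j')).
  case: j j' => [j lt_j] [j' lt_j']; have lt_i := ltn_ord i.
  rewrite (@zends_cell (Zn i) 0 (Zn (m - i - 1)) (0, 1, 0, 0)%bZ (1, 1, 0, 1)%bZ);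
    try by rewrite /eval; lia.
  rewrite (@zends_fixed (Zn i) 0 (Zn (m - i - 1)) (1, 1, 0, 1)%bZ) //;
    try by rewrite /eval; lia.
  by apply: cross_partedP fixed_cell_parted _ _ _ => //; lia.
case: c c' => [j|[i j]] [j'|[i' j']] neq.
- case: j j' neq => [j lt_j] [j' lt_j'] neq.
  rewrite !(@zends_fixed 0 0 (Zn m) (0, 0, 0, 1)%bZ) //;
    try by rewrite /eval; lia.
  have neq_j : j != j'.
    by apply: contraNneq neq => E; apply/eqP; congr inl; exact: val_inj.
  by apply: all_partedP fixed_parted _ _ neq_j _ => //; lia.
- by have [] := cellf i' j' j.
- by have [] := cellf i j j'.
have [lt_i|gt_i|eq_i] := ltngtP i i'.
- by have [] := cell2 i i' j j' lt_i.
- by have [] := cell2 i' i j' j gt_i.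
move/val_inj: eq_i neq => -> {i} neq; have lt_i := ltn_ord i'.
case: j j' neq => [j lt_j] [j' lt_j'] neq.
rewrite !(@zends_cell (Zn i') 0 (Zn (m - i' - 1)) (0, 1, 0, 0)%bZ (1, 1, 0, 1)%bZ);
  try by rewrite /eval; lia.
have neq_j : j != j'.
  by apply: contraNneq neq => E; apply/eqP; congr (inr (_, _)); exact: val_inj.
by apply: all_partedP cell_parted _ _ neq_j _ => //; lia.
Qed.

Lemma posZ_inj : injective posZ.
Proof.
have ltI (i : 'I_m.+1) : (Zn i <= Zn m)%bZ by have := ltn_ord i; lia.
have hub_block h i r : posZ (inl h) <> posZ (inr (i, r)).
  rewrite /posZ; case: ifP => _; case: h; case: r;
  by rewrite /at_Z /last_coords /block_coords /hub_coords => /pair_equal_spec[]; lia.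
move=> [h|[i r]] [h'|[i' r']].
- by case: h; case: h' => //; rewrite /posZ /at_Z /hub_coords => /pair_equal_spec[]; lia.
- by move/hub_block.
- by move/esym/hub_block.
suff E : posZ (inr (i, r)) = posZ (inr (i', r')) -> i = i' :> nat /\ r = r'.
  by move=> /E[/val_inj-> ->].
have := ltI i; have := ltI i'; rewrite /posZ.
case: (nat_of_ord i =P m) => Ei; case: (nat_of_ord i' =P m) => Ei'; case: r; case: r';
by rewrite /at_Z /last_coords /block_coords => ? ? /pair_equal_spec[*]; split=> //; lia.
Qed.

End Position.

(** * The drawing *)

Section Segments.
Local Open Scope ring_scope.
Variable R : realType.

Definition zr (z : Z) : R := (int_of_Z z)%:~R.

Lemma zrD x y : zr (x + y)%bZ = zr x + zr y.
Proof. by rewrite /zr -intrD -rmorphD. Qed.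

Lemma zrM x y : zr (x * y)%bZ = zr x * zr y.
Proof. by rewrite /zr -intrM -rmorphM. Qed.

Lemma zr_le x y : (x <= y)%bZ -> zr x <= zr y.
Proof. by move=> le_xy; rewrite /zr ler_int; lia. Qed.

Lemma zr_lt x y : (x < y)%bZ -> zr x < zr y.
Proof. by move=> lt_xy; rewrite /zr ltr_int; lia. Qed.

Lemma zr_inj : injective zr.
Proof. by move=> x y /intr_inj; exact: (can_inj int_of_ZK). Qed.

Definition zpt (u : Z * Z) : R * R := (zr u.1, zr u.2).

Lemma zpt_inj : injective zpt.
Proof. by move=> [x y] [x' y'] [/zr_inj-> /zr_inj->]. Qed.

Definition seg (e : segment) (t : R) : R * R :=
  ((1 - t) * zr e.1.1 + t * zr e.2.1, (1 - t) * zr e.1.2 + t * zr e.2.2).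

Lemma seg0 e : seg e 0 = zpt e.1.
Proof. by rewrite /seg subr0 !mul1r !mul0r !addr0. Qed.

Lemma seg1 e : seg e 1 = zpt e.2.
Proof. by rewrite /seg subrr !mul1r !mul0r !add0r. Qed.

Lemma seg_flip e t : seg (flip e) t = seg e (1 - t).
Proof. by congr pair; rewrite /=; ring. Qed.

Lemma dot_seg d e f s t : seg e s = seg f t ->
  (1 - s) * zr (dot d e.1) + s * zr (dot d e.2) =
  (1 - t) * zr (dot d f.1) + t * zr (dot d f.2).
Proof.
case=> E1 E2; rewrite /dot !zrD !zrM.
transitivity (zr d.1 * ((1 - s) * zr e.1.1 + s * zr e.2.1) +
              zr d.2 * ((1 - s) * zr e.1.2 + s * zr e.2.2)); first by ring.
by rewrite E1 E2; ring.
Qed.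

(** Along [d], both segments advance from the common end at the same speed, so
    they could only meet at equal times, and then their other ends coincide. *)
Lemma fan_avoid e f s t : fan e f -> s != 0 -> seg e s <> seg f t.
Proof.
case=> E1 [d [E2 neq neq2]] s0 E.
have := dot_seg d E; rewrite -E1 -E2 => /eqP Ed.
have st : s = t.
  apply/eqP; rewrite -subr_eq0; apply/eqP.
  have : (s - t) * (zr (dot d e.2) - zr (dot d e.1)) = 0.
    by move/eqP: Ed => Ed; rewrite mulrBl; lra.
  by move/eqP; rewrite mulf_eq0 [X in _ || X]subr_eq0 => /orP[/eqP//|/eqP/zr_inj/esym].
case: E; rewrite -st -E1 => /addrI/(mulfI s0)/zr_inj Ex /addrI/(mulfI s0)/zr_inj Ey.
by apply: neq2; rewrite (surjective_pairing e.2) Ex Ey -surjective_pairing.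
Qed.

Lemma average_le (t c d x : R) : 0 <= t <= 1 -> c <= x -> d <= x ->
  (1 - t) * c + t * d <= x.
Proof.
move=> /andP[t0 t1] cx dx.
have -> : x = (1 - t) * x + t * x by ring.
by apply: lerD; apply: ler_wpM2l; rewrite ?subr_ge0.
Qed.

Lemma average_lt (t c d x : R) : 0 <= t <= 1 -> c < x -> d < x ->
  (1 - t) * c + t * d < x.
Proof.
move=> t01 cx dx; apply: (@le_lt_trans _ _ (Num.max c d)); last by rewrite gt_max cx.
by apply: average_le => //; rewrite le_max lexx ?orbT.
Qed.

Lemma strict_average (s t a b c d : R) : 0 < s < 1 -> 0 <= t <= 1 ->
  (1 - s) * a + s * b = (1 - t) * c + t * d ->
  c < a -> d < a -> c < b -> d < b -> False.
Proof.
move=> /andP[s0 s1] t01 E ca da cb db.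
have s01 : 0 <= s <= 1 by rewrite !ltW.
have := average_lt s01 (_ : - a < - ((1 - t) * c + t * d)) (_ : - b < - ((1 - t) * c + t * d)).
rewrite !ltrN2 => /(_ (average_lt t01 ca da) (average_lt t01 cb db)); lra.
Qed.

Lemma weak_average (s t a b c d : R) : 0 < s < 1 -> 0 <= t <= 1 ->
  (1 - s) * a + s * b = (1 - t) * c + t * d ->
  a != b -> c <= a -> d <= a -> c <= b -> d <= b -> False.
Proof.
move=> /andP[s0 s1] t01 E ab ca da cb db.
have := average_le t01 ca da; have := average_le t01 cb db; rewrite -E.
case: (ltgtP a b) ab => // lt_ab _.
  have := mulr_gt0 s0 (_ : 0 < b - a); rewrite subr_gt0 => /(_ lt_ab); lra.
have := mulr_gt0 (_ : 0 < 1 - s) (_ : 0 < a - b).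
rewrite !subr_gt0 => /(_ s1 lt_ab); lra.
Qed.

Lemma parted_avoid e f s t : parted e f -> 0 < s < 1 -> 0 <= t <= 1 ->
  seg e s <> seg f t.
Proof.
move=> ef s01 t01 E; have /andP[s0 s1] := s01.
have s0' : s != 0 by rewrite gt_eqF.
have s1' : 1 - s != 0 by rewrite subr_eq0 gt_eqF.
case: ef => [[d [[le11 le21 le12 le22] neq]]|[[d [lt11 lt21 lt12 lt22]]|]].
- have neq' : zr (dot d e.1) != zr (dot d e.2) by apply/eqP => /zr_inj.
  move: (dot_seg d E) neq' (zr_le le11) (zr_le le21) (zr_le le12) (zr_le le22).
  exact: weak_average s01 t01.
- move: (dot_seg d E) (zr_lt lt11) (zr_lt lt21) (zr_lt lt12) (zr_lt lt22).
  exact: strict_average s01 t01.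
case=> /fan_avoid fanP.
- exact: (fanP s t).
- by apply: (fanP s (1 - t)) => //; rewrite seg_flip subKr.
- by apply: (fanP (1 - s) t) => //; rewrite seg_flip subKr.
- by apply: (fanP (1 - s) (1 - t)) => //; rewrite !seg_flip !subKr.
Qed.

Lemma seg_inj e : e.1 <> e.2 -> injective (seg e).
Proof.
move=> neq s t [].
have [E1|/eqP neq1] := Z.eq_dec e.1.1 e.2.1; last first.
  move=> E _; apply/eqP; rewrite -subr_eq0.
  have : (s - t) * (zr e.2.1 - zr e.1.1) = 0 by lra.
  by move/eqP; rewrite mulf_eq0 [X in _ || X]subr_eq0
    (inj_eq zr_inj) [_ == e.1.1]eq_sym (negbTE neq1) orbF.
have neq2 : e.1.2 != e.2.2.
  apply/eqP => E2; apply: neq.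
  by rewrite (surjective_pairing e.1) E1 E2 -surjective_pairing.
move=> _ E; apply/eqP; rewrite -subr_eq0.
have : (s - t) * (zr e.2.2 - zr e.1.2) = 0 by lra.
by move/eqP; rewrite mulf_eq0 [X in _ || X]subr_eq0
    (inj_eq zr_inj) [_ == e.1.2]eq_sym (negbTE neq2) orbF.
Qed.

Lemma continuous_seg e : continuous (seg e).
Proof.
have lin (a b : R) : continuous (fun t : R => (1 - t) * a + t * b).
  move=> t; apply: cvgD; apply: cvgM; try exact: cvg_cst; last exact: cvg_id.
  by apply: cvgB; [exact: cvg_cst | exact: cvg_id].
move=> t; exact: (cvg_pair (lin (zr e.1.1) (zr e.2.1) t) (lin (zr e.1.2) (zr e.2.2) t)).
Qed.

Variable m : nat.

Lemma zends_neq (c : edge_code m) : (zends c).1 <> (zends c).2.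
Proof. by move/posZ_inj/eqP; apply/negP; exact: ends_neq. Qed.

(** Two codes of one edge would draw the same segment twice, and its midpoint
    would be common to both. *)
Lemma edge_set_inj : injective (@edge_set m).
Proof.
move=> c c' E; apply/eqP/negPn/negP => /zends_parted part.
have half : 0 < (1 / 2 : R) < 1 by lra.
have half' : 0 <= (1 / 2 : R) <= 1 by lra.
have [] := parted_avoid part half half'.
have : (ends c).1 \in edge_set c' by rewrite -E set21.
have : (ends c).2 \in edge_set c' by rewrite -E set22.
rewrite !inE /seg /zends => /orP[]/eqP E2 /orP[]/eqP E1; have := ends_neq c;
  rewrite E1 E2 ?eqxx //= => _.
by congr pair; field.
Qed.

Lemma card_strip_edges : #|edges (strip m)| = (14 * m.+1 + 12)%N.
Proof.
rewrite card_imset; last exact: edge_set_inj.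
by rewrite card_sum card_prod !card_ord; lia.
Qed.

Definition arc_of (e : {set vtx m}) : R -> R * R :=
  if [pick c | edge_set c == e] is Some c then seg (zends c) else fun=> 0.

Lemma arc_of_edge (c : edge_code m) : arc_of (edge_set c) = seg (zends c).
Proof.
rewrite /arc_of; case: pickP => [c' /eqP/edge_set_inj-> //|/(_ c)].
by rewrite eqxx.
Qed.

Definition incident (v : vtx m) (c : edge_code m) := v = (ends c).1 \/ v = (ends c).2.

(** Indices in [fixed_edges], respectively in [cell_edges], of two edges at each
    vertex.  The block edges come in [fixed_edges] in the same order, from index
    13 on. *)
Definition two_at_hub h : nat * nat :=
  match h with
  | hU => (8, 12) | hD => (9, 11) | hP => (0, 1) | hE => (0, 2) | hF => (1, 2)
  | hG => (3, 7) | hH => (6, 9)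
  end%N.

Definition two_at_role r : nat * nat :=
  match r with
  | rx => (1, 2) | ry => (3, 4) | ra => (1, 3) | rb => (4, 5) | rc => (2, 6)
  | rd => (8, 9)
  end%N.

Lemma two_incident v : exists c c', [/\ c != c', incident v c & incident v c'].
Proof.
case: v => [h|[i r]].
  exists (inl (inord (two_at_hub h).1)), (inl (inord (two_at_hub h).2)).
  by split; case: h => /=; rewrite /incident /= ?inordK //; try (by left); try (by right);
     apply/eqP => -[/(congr1 val)]; rewrite /= !inordK.
have [lt_i|ge_i] := ltnP i m.
  have blockE s : block m i s = inr (i, s) by rewrite /block inord_val.
  exists (inr (Ordinal lt_i, inord (two_at_role r).1)),
    (inr (Ordinal lt_i, inord (two_at_role r).2)).
  by split; case: r => /=; rewrite /incident /= ?inordK //= ?blockE;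
     try (by left); try (by right);
     apply/eqP => -[/(congr1 val)]; rewrite /= !inordK.
have -> : i = inord m by apply: val_inj; rewrite /= inordK //; have := ltn_ord i; lia.
exists (inl (inord (13 + (two_at_role r).1))), (inl (inord (13 + (two_at_role r).2))).
by split; case: r => /=; rewrite /incident /= ?inordK //=; try (by left); try (by right);
   apply/eqP => -[/(congr1 val)]; rewrite /= !inordK.
Qed.

(** Used to keep edges away from vertices: a vertex is an end of another edge,
    and different edges are already known to be apart. *)
Lemma other_edge (v : vtx m) (c : edge_code m) : exists2 c', c' != c & incident v c'.
Proof.
have [c1 [c2 [neq v1 v2]]] := two_incident v.
have [E|] := eqVneq c1 c; last by exists c1.
by exists c2; rewrite // -E eq_sym.
Qed.

Lemma strip_planar : planar R (strip m).
Proof.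
exists (fun v => zpt (posZ v)), arc_of; split.
- by move=> u v /zpt_inj /posZ_inj.
- move=> _ /imsetP[c _ ->]; rewrite arc_of_edge.
  exact/continuous_subspaceT/continuous_seg.
- move=> _ /imsetP[c _ ->] s t _ _; rewrite arc_of_edge.
  by apply: seg_inj; exact: zends_neq.
- move=> _ /imsetP[c _ ->]; rewrite arc_of_edge seg0 seg1.
  apply/seteqP; split=> [_ [->|->]|_ [v /= + <-]] /=.
  + by exists (ends c).1; rewrite //= set21.
  + by exists (ends c).2; rewrite //= set22.
  + by rewrite !inE => /orP[]/eqP->; [left|right].
- move=> _ /imsetP[c _ ->] s v; rewrite in_itv arc_of_edge /= => s01 E.
  have [c' neq vE] := other_edge v c; rewrite eq_sym in neq.
  case: vE E => ->.
  + by rewrite -(seg0 (zends c')); apply: parted_avoid (zends_parted neq) s01 _;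
      rewrite lexx ler01.
  + by rewrite -(seg1 (zends c')); apply: parted_avoid (zends_parted neq) s01 _;
      rewrite lexx ler01.
- move=> _ _ /imsetP[c _ ->] /imsetP[c' _ ->] neq s t; rewrite !in_itv /= => s01 t01.
  rewrite !arc_of_edge; apply: parted_avoid s01 t01; apply: zends_parted.
  by apply: contraNneq neq => ->.
Qed.

End Segments.

Theorem theorem2p2 (R : realType) (k : nat) (hk : 0 < k) :
  exists G : sgraph,
    [/\ critical 4 G, planar R G, #|G| = 6 * k + 7
      & #|edges G| = 14 * k + 12].
Proof.
case: k hk => // m _; exists (strip m); split.
- split; first exact: strip_not_colorable.
  by move=> _ /imsetP[c _ ->]; exact: strip_edge_critical.
- exact: strip_planar.
- exact: card_strip.
- exact: (card_strip_edges R).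
Qed.
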